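(* Let $m\ge 3$ be an odd integer. Then the graph $G_{\alpha}(m;1,1,1)$ is a snark, i.e., it is a cubic graph that admits no proper $3$-edge-coloring.
   Context: Let $G$ be the graph with the 11 vertices $A,B,A',B',v,x_1,\dots,x_6$ and the 14 edges $Av,\ vA',\ Ax_6,\ x_6x_2,\ x_6x_5,\ x_2x_4,\ x_2B,\ x_4x_3,\ x_4B',\ x_3A',\ x_3x_5,\ x_5x_1,\ x_1B,\ x_1B'$ (so $A,B,A',B',v$ have degree 2 and $x_1,\dots,x_6$ have degree 3). For integers $m\ge 3$, $a,b$ with $1\le a,b\le m-1$ and $c$ with $1\le c<m/2$, the graph $G_{\alpha}(m;a,b,c)$ has vertex set $\{u_i: u\in V(G),\ i\in\mathbb{Z}_m\}\cup\{w_i: i\in\mathbb{Z}_m\}$ and edges: $u_iu'_i$ for every edge $uu'$ of $G$ and every $i$; the spoke edges $v_iw_i$; the loop edges $w_iw_{i+c}$; and the connecting edges $A'_iA_{i+a}$ and $B'_iB_{i+b}$ (all indices modulo $m$). It is a cubic graph on $12m$ vertices. A snark is a cubic graph whose chromatic index is 4. *)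

(* Defs.v *)
From HB Require Import structures.
From mathcomp Require Import all_boot all_order all_algebra.

Set Implicit Arguments.
Unset Strict Implicit.
Unset Printing Implicit Defensive.

Import GRing.Theory.

Section SimpleGraphs.

Variables (T : finType) (e : rel T).

Definition simple_graph : Prop := symmetric e /\ irreflexive e.

Definition neighbours (x : T) : {set T} := [set y | e x y].

Definition cubic_graph : Prop :=
  simple_graph /\ forall x : T, #|neighbours x| = 3.

Definition edges : {set {set T}} :=
  [set [set p.1; p.2] | p : T * T & e p.1 p.2].

(* The colours are 0, ..., k - 1; the values of col outside edges are
   irrelevant. *)
Definition proper_edge_coloring (k : nat) (col : {set T} -> nat) : Prop :=
  (forall E : {set T}, E \in edges -> col E < k) /\
  (forall E F : {set T}, E \in edges -> F \in edges ->
     E != F -> E :&: F != set0 -> col E != col F).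

Definition edge_colorable (k : nat) : Prop :=
  exists col : {set T} -> nat, proper_edge_coloring k col.

Definition chromatic_index_is (k : nat) : Prop :=
  edge_colorable k /\ forall j : nat, edge_colorable j -> k <= j.

Definition snark : Prop := cubic_graph /\ chromatic_index_is 4.

End SimpleGraphs.

(* vA' and vB' are the vertices A' and B'. *)
Inductive Gvertex : Type :=
  vA | vB | vA' | vB' | vv | x1 | x2 | x3 | x4 | x5 | x6.

Definition Gvertex_enum : seq Gvertex :=
  [:: vA; vB; vA'; vB'; vv; x1; x2; x3; x4; x5; x6].

Definition Gvertex_code (u : Gvertex) : nat :=
  match u with
  | vA => 0 | vB => 1 | vA' => 2 | vB' => 3 | vv => 4
  | x1 => 5 | x2 => 6 | x3 => 7 | x4 => 8 | x5 => 9 | x6 => 10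
  end.

Definition Gvertex_decode (n : nat) : Gvertex := nth vA Gvertex_enum n.

Lemma Gvertex_codeK : cancel Gvertex_code Gvertex_decode.
Proof. by case. Qed.

HB.instance Definition _ := Countable.copy Gvertex (can_type Gvertex_codeK).

Lemma Gvertex_enumP : Finite.axiom Gvertex_enum.
Proof. by case. Qed.

HB.instance Definition _ := isFinite.Build Gvertex Gvertex_enumP.

Definition Gedges : seq (Gvertex * Gvertex) :=
  [:: (vA, vv); (vv, vA'); (vA, x6); (x6, x2); (x6, x5); (x2, x4); (x2, vB);
      (x4, x3); (x4, vB'); (x3, vA'); (x3, x5); (x5, x1); (x1, vB); (x1, vB')].

(* inl (u, i) is the vertex u_i and inr i is the vertex w_i. The type 'Z_m is
   the ring of integers modulo m only for m >= 2. *)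
Definition Galpha_vertex (m : nat) : finType := (Gvertex * 'Z_m + 'Z_m)%type.

(* One orientation of each edge of G_alpha(m; a, b, c). *)
Definition Galpha_arc (m a b c : nat) (p q : Galpha_vertex m) : bool :=
  match p, q with
  | inl (u, i), inl (u', j) =>
      [|| ((u, u') \in Gedges) && (j == i),
          [&& u == vA', u' == vA & j == (i + a%:R)%R]
        | [&& u == vB', u' == vB & j == (i + b%:R)%R]]
  | inl (u, i), inr j => (u == vv) && (j == i)
  | inr i, inr j => j == (i + c%:R)%R
  | inr _, inl _ => false
  end.

Definition Galpha (m a b c : nat) : rel (Galpha_vertex m) :=
  fun p q => Galpha_arc a b c p q || Galpha_arc a b c q p.

(* Main.v *)
(* Let a, b, w be the colours (0, 1 or 2) of the edges A'_(i-1) A_i,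
   B'_(i-1) B_i and w_(i-1) w_i in a proper 3-edge-colouring. Enumerating the
   colourings of one block shows that the element
   a + b + w + (a - b)(b - w)(w - a) of Z/3 is nonzero and changes sign when
   i becomes i + 1. Hence going once around the m blocks forces m to be even.
   Four colours suffice because one block, with its connecting edges closed up,
   has a 4-edge-colouring, which can be repeated in all blocks. *)

Require Import Defs.
From mathcomp Require Import all_boot all_order all_algebra.

Set Implicit Arguments.
Unset Strict Implicit.
Unset Printing Implicit Defensive.

Import GRing.Theory.

(** * Edge colourings through adjacency lists *)

Section AdjacencyLists.

Variables (T : finType) (e : rel T) (nbs : T -> seq T).
Hypothesis nbsP : forall x y, e x y = (y \in nbs x).

(** Colouring ordered pairs instead of two-element sets turns properness into a condition on one
    list per vertex. *)
Definition proper_at (k : nat) (c : T -> T -> nat) (x : T) : bool :=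
  uniq (map (c x) (nbs x)) && all (fun y => c x y < k) (nbs x).

Lemma edge_colorable_proper_at (k : nat) :
  irreflexive e -> (forall x, uniq (nbs x)) -> edge_colorable e k ->
  exists c : T -> T -> nat,
    (forall x y, c x y = c y x) /\ (forall x, proper_at k c x).
Proof.
move=> irr uniq_nbs [col [lt_col ne_col]].
have edgeP x y : e x y -> [set x; y] \in edges e.
  by move=> exy; apply/imsetP; exists (x, y) => //; rewrite inE.
exists (fun x y => col [set x; y]); split=> [x y|x]; first by rewrite setUC.
apply/andP; split; last first.
  by apply/allP => y; rewrite -nbsP => /edgeP /lt_col.
rewrite map_inj_in_uniq // => y z; rewrite -!nbsP => exy exz.
apply: contra_eq => neq_yz; apply: ne_col; rewrite ?edgeP //; last first.
  by apply/set0Pn; exists x; rewrite !inE eqxx.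
(* The vertex [y] will separate the two edges: it differs from both [x] and [z]. *)
have neq_yx : y != x by apply: contraTneq exy => ->; rewrite irr.
apply/eqP => /setP /(_ y).
by rewrite !inE eqxx orbT (negbTE neq_yx) (negbTE neq_yz).
Qed.

Lemma proper_at_edge_colorable (k : nat) (c : T -> T -> nat) :
  simple_graph e -> (forall x y, e x y -> c x y = c y x) ->
  (forall x, proper_at k c x) -> edge_colorable e k.
Proof.
move=> [sym irr] symc pc.
(* Any orientation of [E] will do, since [c] is symmetric on edges; the value 0 off the edges is a
   dummy. *)
pose col (E : {set T}) :=
  if [pick p : T * T | e p.1 p.2 && (E == [set p.1; p.2])] is Some p
  then c p.1 p.2 else 0.
have colE x y : e x y -> col [set x; y] = c x y.
  move=> exy; rewrite /col; case: pickP => [[z t] /= /andP [ezt /eqP Ezt]|].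
    have [zx|neq_zx] := eqVneq z x; have [ty|neq_ty] := eqVneq t y.
    - by rewrite zx ty.
    - move/setP/(_ t): Ezt; rewrite !inE eqxx orbT (negbTE neq_ty) orbF.
      by move/eqP=> tx; move: ezt; rewrite zx tx irr.
    - move/setP/(_ z): Ezt; rewrite !inE eqxx (negbTE neq_zx).
      by move/eqP=> zy; move: ezt; rewrite zy ty irr.
    move/setP: Ezt => Ezt.
    have := Ezt z; rewrite !inE eqxx (negbTE neq_zx) /= => /eqP zy.
    have := Ezt t; rewrite !inE eqxx (negbTE neq_ty) orbF orbT => /eqP tx.
    by rewrite zy tx -symc.
  by move/(_ (x, y)); rewrite /= exy eqxx.
exists col; split=> [E /imsetP [[x y]]|E F].
  rewrite inE /= => exy ->; rewrite colE //.
  by have /andP [_ /allP] := pc x; apply; rewrite -nbsP.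
have neq_at x y z : e x y -> e x z -> [set x; y] != [set x; z] ->
    c x y != c x z.
  move=> exy exz; apply: contra_neq => eqc; congr [set x; _].
  have /andP [uc _] := pc x.
  have ltn_idx t : e x t -> index t (nbs x) < size (map (c x) (nbs x)).
    by rewrite size_map index_mem -nbsP.
  have nth_idx t : e x t -> nth 0 (map (c x) (nbs x)) (index t (nbs x)) = c x t.
    by move=> ext; rewrite (nth_map x) ?nth_index ?index_mem -?nbsP.
  have := nth_uniq 0 (ltn_idx _ exy) (ltn_idx _ exz) uc.
  rewrite !nth_idx // eqc eqxx => /esym/eqP eqi.
  by rewrite -(@nth_index _ x y (nbs x)) -?nbsP // eqi nth_index -?nbsP.
(* Two meeting edges can thus both be written from a common vertex, where [neq_at] compares them. *)
have oriented A x : A \in edges e -> x \in A ->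
    exists y, [/\ e x y, A = [set x; y] & col A = c x y].
  move=> /imsetP [[y z]]; rewrite inE /= => eyz ->.
  rewrite !inE => /orP [] /eqP ->.
    by exists z; rewrite colE.
  by exists y; split; [rewrite sym | rewrite setUC | rewrite colE // symc].
move=> eE eF neqEF /set0Pn [x]; rewrite inE => /andP [xE xF].
have [y [exy defE ->]] := oriented _ _ eE xE.
have [z [exz defF ->]] := oriented _ _ eF xF.
by apply: neq_at; rewrite -?defE -?defF.
Qed.

(** Allows a colouring to be given as a table: [cols x] follows the order of [nbs x], and the last
    hypothesis makes both ends of an edge agree on its colour. *)
Lemma proper_table_edge_colorable (k : nat) (cols : T -> seq nat) :
  simple_graph e -> (forall x, uniq (nbs x)) ->
  (forall x, size (cols x) = size (nbs x)) ->
  (forall x, uniq (cols x) && all (fun a => a < k) (cols x)) ->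
  (forall x y a,
     (y, a) \in zip (nbs x) (cols x) -> (x, a) \in zip (nbs y) (cols y)) ->
  edge_colorable e k.
Proof.
move=> simple_e uniq_nbs size_cols cols_ok sym_cols.
pose c x y := nth 0 (cols x) (index y (nbs x)).
have c_zip x y : y \in nbs x -> (y, c x y) \in zip (nbs x) (cols x).
  move=> y_x; apply/(nthP (x, 0)); exists (index y (nbs x)).
    by rewrite size1_zip ?size_cols // index_mem.
  by rewrite nth_zip ?size_cols // nth_index.
have zip_c x y a : (y, a) \in zip (nbs x) (cols x) -> a = c x y.
  case/(nthP (x, 0)) => i; rewrite size1_zip ?size_cols // => lt_i.
  by rewrite nth_zip ?size_cols // => -[<- <-]; rewrite /c index_uniq.
apply: (@proper_at_edge_colorable k c) => // [x y|x].
  by rewrite nbsP => /c_zip /sym_cols /zip_c.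
have E : map (c x) (nbs x) = cols x.
  apply: (@eq_from_nth _ 0) => [|i]; rewrite size_map ?size_cols // => lti.
  by rewrite (nth_map x) // /c index_uniq.
rewrite /proper_at E; have /andP [-> a_cols] := cols_ok x.
by move: a_cols; rewrite -{1}E all_map.
Qed.

End AdjacencyLists.

(** * Three-colourings of one block *)

Definition proper3 (x y z : nat) : bool :=
  uniq [:: x; y; z] && all (fun a => a < 3) [:: x; y; z].

(* The value in Z/3 is a + b + w when exactly two of the colours coincide and
   minus the sign of the permutation (a, b, w) when they are distinct; it is 0
   only if a = b = w, which does not occur. *)
Definition state_parity (a b w : nat) : bool :=
  (a + b + w + (a + b.*2) * (b + w.*2) * (w + a.*2)) %% 3 == 1.

(** The colours 0, 1, 2 sum to 3, so two of them determine the third; this keeps the enumeration of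
    a block small. *)
Lemma proper3P x y z :
  proper3 x y z -> [/\ x < 3, y < 3, x != y & z = 3 - (x + y)].
Proof.
case/andP=> uniq_xyz /and4P [lt_x3 lt_y3 lt_z3 _].
move: x y z lt_x3 lt_y3 lt_z3 uniq_xyz.
by case=> [|[|[|//]]]; case=> [|[|[|//]]]; case=> [|[|[|//]]].
Qed.

(* Each variable is the colour of the edge it names: a, b, w are the edges that
   enter the block, a', b', w' those that leave it, and sp is the spoke. *)
Lemma block_parity
    (a b w a' b' w' sp av va' ax6 x62 x65 x24 x2b x43 x4b' x3a' x35 x51 x1b
     x1b' : nat) :
  proper3 av ax6 a -> proper3 av va' sp -> proper3 sp w' w ->
  proper3 ax6 x62 x65 -> proper3 x62 x24 x2b -> proper3 x24 x43 x4b' ->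
  proper3 va' x3a' a' -> proper3 x43 x3a' x35 -> proper3 x65 x35 x51 ->
  proper3 x51 x1b x1b' -> proper3 x2b x1b b -> proper3 x4b' x1b' b' ->
  state_parity a' b' w' = ~~ state_parity a b w.
Proof.
case/proper3P=> lt_av lt_ax6 n1 -> /proper3P [_ lt_va' n2 ->].
case/proper3P=> _ lt_w' n3 ->.
move: lt_av lt_ax6 n1 lt_va' n2 lt_w' n3.
case: av => [|[|[|//]]] _; case: ax6 => [|[|[|//]]] _ // _;
case: va' => [|[|[|//]]] _ // _; case: w' => [|[|[|//]]] _ // _;
  (* From here on every vertex has an edge already coloured, so at most one colour is chosen at
     each; clashes are discarded at once. *)
  case/proper3P=> _ + + ->; case: x62 => [|[|[|//]]] _ // _;
  case/proper3P=> _ + + ->; case: x24 => [|[|[|//]]] _ // _;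
  case/proper3P=> _ + + ->; case: x43 => [|[|[|//]]] _ // _;
  case/proper3P=> _ + + ->; case: x3a' => [|[|[|//]]] _ // _;
  case/proper3P=> _ _ + ->; move=> // _; case/proper3P=> _ _ + ->; move=> // _;
  case/proper3P=> _ + + ->; case: x1b => [|[|[|//]]] _ // _;
  case/proper3P=> _ _ + ->; move=> // _; case/proper3P=> _ _ + ->; move=> // _;
  reflexivity.
Qed.

(** * Adjacency lists of the graph, and cubicity *)

Section Graph.

Variable m : nat.
Hypothesis m_ge3 : 3 <= m.

Local Notation V := (Galpha_vertex m).
Local Open Scope ring_scope.

(** Each list is in the order in which [block_parity] takes the edges at that vertex. *)
Definition Galpha_nbs (p : V) : seq V :=
  match p with
  | inr i => [:: inl (vv, i); inr (i + 1); inr (i - 1)]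
  | inl (u, i) =>
    match u with
    | vA => [:: inl (vv, i); inl (x6, i); inl (vA', i - 1)]
    | vB => [:: inl (x2, i); inl (x1, i); inl (vB', i - 1)]
    | vA' => [:: inl (vv, i); inl (x3, i); inl (vA, i + 1)]
    | vB' => [:: inl (x4, i); inl (x1, i); inl (vB, i + 1)]
    | vv => [:: inl (vA, i); inl (vA', i); inr i]
    | x1 => [:: inl (x5, i); inl (vB, i); inl (vB', i)]
    | x2 => [:: inl (x6, i); inl (x4, i); inl (vB, i)]
    | x3 => [:: inl (x4, i); inl (vA', i); inl (x5, i)]
    | x4 => [:: inl (x2, i); inl (x3, i); inl (vB', i)]
    | x5 => [:: inl (x6, i); inl (x3, i); inl (x1, i)]
    | x6 => [:: inl (vA, i); inl (x2, i); inl (x5, i)]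
    end
  end.

Lemma Galpha_nbsP (p q : V) : Galpha 1 1 1 p q = (q \in Galpha_nbs p).
Proof.
have inlE (u u' : Gvertex) (i j : 'Z_m) :
  ((inl (u, i) : V) == inl (u', j)) = (u == u') && (i == j) by [].
have inrE (i j : 'Z_m) : ((inr i : V) == inr j) = (i == j) by [].
have mixE (u : Gvertex) (i j : 'Z_m) :
  ((inl (u, i) : V) == inr j) = false by [].
have mixE' (u : Gvertex) (i j : 'Z_m) :
  ((inr j : V) == inl (u, i)) = false by [].
(* A reversed arc gives the index equation on the left, while the lists use the one on the right. *)
have prevE (i j : 'Z_m) : (i == j + 1) = (j == i - 1).
  by rewrite -subr_eq eq_sym.
case: p q => [[u i]|i] [[u' j]|j]; rewrite /Galpha /Galpha_arc.
- rewrite (prevE i j) (eq_sym i j); case: u; rewrite !inE !inlE;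
  case: (j == i); case: (j == i + 1); case: (j == i - 1); case: u'; reflexivity.
- by case: u; rewrite !inE !mixE' ?inrE; case: (j == i).
- by rewrite (eq_sym i j) !inE !mixE inlE; case: (j == i); case: u'.
- by rewrite (prevE i j) !inE !mixE' !inrE.
Qed.

Lemma val_Zp_succ (i : 'Z_m) : val (i + 1) = ((val i).+1 %% m)%N.
Proof.
rewrite /=; move: (nat_of_ord i) => n.
by rewrite Zp_cast ?(ltn_trans _ m_ge3) // modnDmr addn1.
Qed.

Lemma Zp_succ_neq (i : 'Z_m) : (i + 1 == i) = false.
Proof. by rewrite -subr_eq0 addrAC subrr add0r oner_eq0. Qed.

(** Equality would mean 2 = 0 in ['Z_m], which [m_ge3] excludes; hence the two loop edges at [w_i]
    are distinct. *)
Lemma Zp_succ_neq_pred (i : 'Z_m) : (i + 1 == i - 1) = false.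
Proof.
rewrite (inj_eq (addrI i)) -subr_eq0 opprK.
by apply/negbTE; rewrite -val_eqE val_Zp_succ /= modn_small.
Qed.

Lemma uniq_Galpha_nbs (p : V) : uniq (Galpha_nbs p).
Proof.
case: p => [[u i]|i]; first by case: u.
apply/and3P; split=> //; rewrite inE.
exact/negbT/(Zp_succ_neq_pred i).
Qed.

Lemma simple_Galpha : simple_graph (@Galpha m 1 1 1).
Proof.
split=> [p q|p]; first by rewrite /Galpha orbC.
case: p => [[u i]|i]; first by rewrite Galpha_nbsP; case: u.
by rewrite /Galpha /Galpha_arc orbb eq_sym Zp_succ_neq.
Qed.

Lemma cubic_Galpha : cubic_graph (@Galpha m 1 1 1).
Proof.
split=> [|p]; first exact: simple_Galpha.
have -> : neighbours (@Galpha m 1 1 1) p = [set q in Galpha_nbs p].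
  by apply/setP => q; rewrite !inE Galpha_nbsP.
rewrite cardsE (card_uniqP _) ?uniq_Galpha_nbs //.
by case: p => [[[]]|].
Qed.

(** * A 4-edge-colouring *)

(* All blocks get the same colours, with colour 3 on the spokes, so that the
   cycle through the w_i can be coloured 0, 1, 0, 1, ..., 2. *)
Definition loop_color (i : 'Z_m) : nat :=
  (if val i == m.-1 then 2 else odd (val i))%N.

(* The colours are listed in the order of Galpha_nbs. *)
Definition four_coloring (p : V) : seq nat :=
  match p with
  | inr i => [:: 3; loop_color i; loop_color (i - 1)%R]
  | inl (u, i) =>
    match u with
    | vA => [:: 0; 1; 3]
    | vB => [:: 2; 1; 0]
    | vA' => [:: 1; 2; 3]
    | vB' => [:: 2; 3; 0]
    | vv => [:: 0; 1; 3]
    | x1 => [:: 0; 1; 3]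
    | x2 => [:: 0; 1; 2]
    | x3 => [:: 0; 2; 1]
    | x4 => [:: 1; 0; 2]
    | x5 => [:: 2; 1; 0]
    | x6 => [:: 1; 0; 2]
    end
  end%N.

Lemma loop_color_succ (i : 'Z_m) : loop_color (i + 1) != loop_color i.
Proof.
rewrite /loop_color val_Zp_succ; set n := val i.
have lt_nm : (n < m)%N.
  by apply: leq_trans (ltn_ord i) _; rewrite Zp_cast ?(ltn_trans _ m_ge3).
have m_gt0 : (0 < m)%N by apply: leq_trans m_ge3.
(* At the wrap-around, index [m.-1] has colour 2 and its successor 0 has colour 0. *)
have [->|neq_n] := eqVneq n m.-1.
  by rewrite prednK // modnn; case: m m_ge3 => [|[|]].
have lt_n1m : (n.+1 < m)%N.
  by rewrite -(ltn_predK m_gt0) ltnS ltn_neqAle neq_n -ltnS prednK.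
by rewrite modn_small //; case: ifP => _ /=; case: (odd n).
Qed.

Lemma Galpha_4_edge_colorable : edge_colorable (@Galpha m 1 1 1) 4.
Proof.
apply: (@proper_table_edge_colorable _ _ _ Galpha_nbsP _ four_coloring).
- exact: simple_Galpha.
- exact: uniq_Galpha_nbs.
- by case=> [[[]]|].
- case=> [[u i]|i]; first by case: u.
  (* The two loop edges at [w_i] differ in colour, and both colours are below the spoke colour 3. *)
  have := loop_color_succ (i - 1); rewrite subrK /=.
  rewrite !inE; rewrite /loop_color; case: ifP => _; case: ifP => _ //;
  by case: odd => //; case: odd.
- case=> [[u i]|i] q a; [case: u|]; rewrite !inE => /or3P [] /eqP [-> ->];
  by rewrite !inE ?subrK ?addrK eqxx ?orbT.
Qed.

(** * Parity around the cycle of blocks *)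

Section ThreeColoring.

Variable c : V -> V -> nat.
Hypotheses (sym_c : forall p q, c p q = c q p)
  (proper_c : forall p, proper_at Galpha_nbs 3 c p).

Let A_color (i : 'Z_m) := c (inl (vA, i)) (inl (vA', i - 1)).
Let B_color (i : 'Z_m) := c (inl (vB, i)) (inl (vB', i - 1)).
Let w_color (i : 'Z_m) := c (inr i) (inr (i - 1)).
Let parity (i : 'Z_m) := state_parity (A_color i) (B_color i) (w_color i).

Lemma parity_succ (i : 'Z_m) : parity (i + 1) = ~~ parity i.
Proof.
have cA := proper_c (inl (vA, i)); have cA' := proper_c (inl (vA', i)).
have cB := proper_c (inl (vB, i)); have cB' := proper_c (inl (vB', i)).
have cv := proper_c (inl (vv, i)); have cw := proper_c (inr i).
have c1 := proper_c (inl (x1, i)); have c2 := proper_c (inl (x2, i)).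
have c3 := proper_c (inl (x3, i)); have c4 := proper_c (inl (x4, i)).
have c5 := proper_c (inl (x5, i)); have c6 := proper_c (inl (x6, i)).
rewrite /parity /A_color /B_color /w_color !addrK.
rewrite (sym_c (inl (vA, i + 1))) (sym_c (inl (vB, i + 1))).
rewrite (sym_c (inr (i + 1))).
pose V_ u : V := inl (u, i).
rewrite -!/(V_ _) in cA cA' cB cB' cv cw c1 c2 c3 c4 c5 c6 *.
(* Each edge gets a single orientation, so that the conditions at its two ends name the same
   colour. *)
rewrite /proper_at /= (sym_c (V_ vv) (V_ vA)) in cv.
rewrite /proper_at /= (sym_c (V_ vA') (V_ vv)) (sym_c (V_ vA') (V_ x3)) in cA'.
rewrite /proper_at /= (sym_c (V_ vB) (V_ x2)) (sym_c (V_ vB) (V_ x1)) in cB.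
rewrite /proper_at /= (sym_c (V_ vB') (V_ x4)) (sym_c (V_ vB') (V_ x1)) in cB'.
rewrite /proper_at /= (sym_c (inr i) (V_ vv)) in cw.
rewrite /proper_at /= (sym_c (V_ x1) (V_ x5)) in c1.
rewrite /proper_at /= (sym_c (V_ x2) (V_ x6)) in c2.
rewrite /proper_at /= (sym_c (V_ x3) (V_ x4)) in c3.
rewrite /proper_at /= (sym_c (V_ x4) (V_ x2)) in c4.
rewrite /proper_at /= (sym_c (V_ x5) (V_ x6)) (sym_c (V_ x5) (V_ x3)) in c5.
rewrite /proper_at /= (sym_c (V_ x6) (V_ vA)) in c6.
exact: (block_parity cA cv cw c6 c2 c4 cA' c3 c5 c1 cB cB').
Qed.

Lemma parity_add (n : nat) : parity n%:R = odd n (+) parity 0.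
Proof.
elim: n => [|n IHn]; first by rewrite addFb.
by rewrite -addn1 natrD parity_succ IHn addn1 /= addNb.
Qed.

Lemma three_coloring_even : ~~ odd m.
Proof.
(* As [m%:R] is 0 in ['Z_m], the parity at 0 equals itself plus [odd m]. *)
have := parity_add m; rewrite pchar_Zp ?(ltn_trans _ m_ge3) //.
by case: (odd m) (parity _) => [] [].
Qed.

End ThreeColoring.

Lemma Galpha_not_3_edge_colorable :
  odd m -> ~ edge_colorable (@Galpha m 1 1 1) 3.
Proof.
move=> odd_m col3; have [_ irr] := simple_Galpha.
have [c [sym_c proper_c]] :=
  edge_colorable_proper_at Galpha_nbsP irr uniq_Galpha_nbs col3.
by have := three_coloring_even sym_c proper_c; rewrite odd_m.
Qed.

End Graph.

(** * The chromatic index *)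

Lemma edge_colorable_leq (T : finType) (e : rel T) (j k : nat) :
  j <= k -> edge_colorable e j -> edge_colorable e k.
Proof.
move=> le_jk [col [lt_col ne_col]]; exists col; split=> // E /lt_col lt_j.
exact: leq_trans lt_j le_jk.
Qed.

Theorem theorem2 (m : nat) (hm : 3 <= m) (hodd : odd m) :
  snark (@Galpha m 1 1 1).
Proof.
split; first exact: cubic_Galpha.
split=> [|j colj]; first exact: Galpha_4_edge_colorable.
rewrite ltnNge; apply/negP => le_j3.
exact: (Galpha_not_3_edge_colorable hm hodd (edge_colorable_leq le_j3 colj)).
Qed.
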